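(* Let $n=2$ and $d\ge1$. Any $2$-antisymmetric polynomial $f\in\mathbb{R}[\boldsymbol{x}_1,\boldsymbol{x}_2]$ can be written in the form $$f(\boldsymbol{x})=\sum_{l=1}^d D_l(\boldsymbol{x})\,g_l(\boldsymbol{x}),\qquad D_l(\boldsymbol{x})=x_{1l}-x_{2l},$$ where $g_1,\dots,g_d\in\mathbb{R}[\boldsymbol{x}_1,\boldsymbol{x}_2]$ are totally symmetric polynomials.
   Context: Here $\boldsymbol{x}=(\boldsymbol{x}_1,\boldsymbol{x}_2)$ with $\boldsymbol{x}_i=(x_{i1},\dots,x_{id})$, and $\mathbb{R}[\boldsymbol{x}_1,\boldsymbol{x}_2]$ is the ring of real polynomials in the $2d$ variables $x_{ij}$. A polynomial $f$ is $2$-antisymmetric if $f(\boldsymbol{x}_2,\boldsymbol{x}_1)=-f(\boldsymbol{x}_1,\boldsymbol{x}_2)$, and totally symmetric if $f(\boldsymbol{x}_2,\boldsymbol{x}_1)=f(\boldsymbol{x}_1,\boldsymbol{x}_2)$. *)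

(* Defs.v *)
From mathcomp Require Import all_boot all_order all_algebra.
From mathcomp Require Import reals.
From mathcomp Require Import mpoly.

Set Implicit Arguments.
Unset Strict Implicit.
Unset Printing Implicit Defensive.

Import GRing.Theory.
Local Open Scope ring_scope.

(* {mpoly R[d + d]} plays the role of R[x_1, x_2]: the first d variables are
   the components of x_1, the last d those of x_2. *)
Definition x1 (R : realType) (d : nat) (l : 'I_d) : {mpoly R[d + d]} :=
  'X_(lshift d l).

Definition x2 (R : realType) (d : nat) (l : 'I_d) : {mpoly R[d + d]} :=
  'X_(rshift d l).

(* f(u, v): the polynomial u l is substituted for x_{1l} and v l for x_{2l}. *)
Definition subst2 (R : realType) (d : nat) (f : {mpoly R[d + d]})
    (u v : 'I_d -> {mpoly R[d + d]}) : {mpoly R[d + d]} :=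
  f \mPo [tuple match split k with inl l => u l | inr l => v l end | k < d + d].

Definition antisymmetric2 (R : realType) (d : nat) (f : {mpoly R[d + d]}) : Prop :=
  subst2 f (@x2 R d) (@x1 R d) = - f.

Definition totally_symmetric (R : realType) (d : nat) (f : {mpoly R[d + d]}) : Prop :=
  subst2 f (@x2 R d) (@x1 R d) = f.

Definition D (R : realType) (d : nat) (l : 'I_d) : {mpoly R[d + d]} :=
  x1 R l - x2 R l.

(* Main.v *)
(** Write S for the exchange of x_1 and x_2. The polynomials p for which p - S p
    has the required form are closed under sums, and also under products because
      2 (p q - S (p q)) = (p - S p) (q + S q) + (q - S q) (p + S p),
    where p + S p and q + S q are symmetric. They contain the constants and the
    variables, hence are all polynomials. An antisymmetric f is 1/2 (f - S f). *)

Require Import Defs.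
From mathcomp Require Import all_boot all_order all_algebra.
From mathcomp Require Import reals.
From mathcomp Require Import mpoly.
From mathcomp Require Import ring.

Import GRing.Theory Num.Theory.
Local Open Scope ring_scope.

(** Constants and variables generate the ring: a polynomial is a sum of constants times products of
    variables. *)
Lemma mpoly_ring_ind (n : nat) (A : comNzRingType) (P : {mpoly A[n]} -> Prop) :
  (forall c, P c%:MP) -> (forall i, P 'X_i) ->
  (forall p q, P p -> P q -> P (p + q)) ->
  (forall p q, P p -> P q -> P (p * q)) ->
  forall p, P p.
Proof.
move=> PC PX PD PM p; rewrite [p]mpolyE.
apply: (big_ind P) => [||m _]; [by rewrite -mpolyC0; apply: PC | exact: PD |].
rewrite -mul_mpolyC mpolyXE_id; apply: (PM); first exact: PC.
apply: (big_ind P) => [||i _]; [by rewrite -mpolyC1; apply: PC | exact: PM |].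
elim: (m i) => [|k IHk]; first by rewrite expr0 -mpolyC1; apply: PC.
by rewrite exprS; apply: PM.
Qed.

Section Swap.
Variables (R : realType) (d : nat).
Implicit Types (p q f : {mpoly R[d + d]}) (l : 'I_d).

Definition swap p : {mpoly R[d + d]} := subst2 p (x2 R (d:=d)) (x1 R (d:=d)).

Lemma swapC c : swap c%:MP = c%:MP.
Proof. exact: comp_mpolyC. Qed.

Lemma swapD : {morph swap : p q / p + q}.
Proof. exact: comp_mpolyD. Qed.

Lemma swapM : {morph swap : p q / p * q}.
Proof. by move=> p q; rewrite /swap /subst2 rmorphM. Qed.

Lemma swap_x1 l : swap (x1 R l) = x2 R l.
Proof.
(* [lshift d l] is [unsplit (inl l)] by computation, so [unsplitK] resolves the [split] in the tuple
   entry. *)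
by rewrite /swap /subst2 comp_mpolyXU -tnth_nth tnth_mktuple (unsplitK (inl l)).
Qed.

Lemma swap_x2 l : swap (x2 R l) = x1 R l.
Proof.
by rewrite /swap /subst2 comp_mpolyXU -tnth_nth tnth_mktuple (unsplitK (inr l)).
Qed.

(** Applying [swap] twice respects sums and products, so it is enough to check constants and
    variables. *)
Lemma swapK : involutive swap.
Proof.
elim/mpoly_ring_ind => [c|i|p q IHp IHq|p q IHp IHq].
- by rewrite !swapC.
- rewrite -[i]splitK; case: (split i) => l /=.
    by rewrite -/(x1 R l) swap_x1 swap_x2.
  by rewrite -/(x2 R l) swap_x2 swap_x1.
- by rewrite !swapD IHp IHq.
- by rewrite !swapM IHp IHq.
Qed.

Lemma swap_sym p : swap (p + swap p) = p + swap p.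
Proof. by rewrite swapD swapK addrC. Qed.

(** The submodule generated by the [D R l] over the ring of symmetric polynomials. *)
Definition symD_span f : Prop :=
  exists g : 'I_d -> {mpoly R[d + d]},
    (forall l, totally_symmetric (g l)) /\ f = \sum_(l < d) D R l * g l.

Lemma symD_span0 : symD_span 0.
Proof.
exists (fun=> 0); split=> [l|]; first by rewrite -mpolyC0; apply: swapC.
by rewrite big1 // => l _; rewrite mulr0.
Qed.

Lemma symD_spanD p q : symD_span p -> symD_span q -> symD_span (p + q).
Proof.
move=> [g [gS ->]] [h [hS ->]]; exists (fun l => g l + h l); split=> [l|].
  by rewrite /totally_symmetric -/(swap _) swapD [swap (g l)]gS [swap (h l)]hS.
by rewrite -big_split; apply: eq_bigr => l _; rewrite mulrDr.
Qed.

Lemma symD_spanM p q : totally_symmetric q -> symD_span p -> symD_span (p * q).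
Proof.
move=> qS [g [gS ->]]; exists (fun l => g l * q); split=> [l|].
  by rewrite /totally_symmetric -/(swap _) swapM [swap (g l)]gS [swap q]qS.
by rewrite mulr_suml; apply: eq_bigr => l _; rewrite mulrA.
Qed.

Lemma symD_spanZ c p : symD_span p -> symD_span (c *: p).
Proof. by rewrite -mul_mpolyC mulrC; apply/symD_spanM/swapC. Qed.

Lemma symD_span_D l : symD_span (D R l).
Proof.
exists (fun k => (k == l)%:R); split=> [k|].
  by rewrite -mpolyC_nat; apply: swapC.
rewrite (bigD1 l) //= eqxx mulr1 big1 ?addr0 // => k /negPf ->.
by rewrite mulr0.
Qed.

Lemma halfZ p : 2^-1 *: (p + p) = p.
Proof. by rewrite -mulr2n -scaler_nat scalerA mulVf ?scale1r ?pnatr_eq0. Qed.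

Lemma symD_span_sub_swap p : symD_span (p - swap p).
Proof.
elim/mpoly_ring_ind: p => [c|i|p q IHp IHq|p q IHp IHq].
- by rewrite swapC subrr; apply: symD_span0.
- rewrite -[i]splitK; case: (split i) => l /=.
    by rewrite -/(x1 R l) swap_x1; apply: symD_span_D.
  (* Here the difference is [- D R l], treated as a scalar multiple by -1. *)
  rewrite -/(x2 R l) swap_x2 -opprB -scaleN1r.
  exact/symD_spanZ/symD_span_D.
- by rewrite swapD opprD addrACA; apply: symD_spanD.
(* Doubling is what makes both cofactors symmetric: in the plain splitting (p - S p) q + S p (q - S
   q) the cofactors q and S p need not be. *)
- rewrite -[_ - _]halfZ swapM; apply: symD_spanZ.
  have -> : p * q - swap p * swap q + (p * q - swap p * swap q) =
      (p - swap p) * (q + swap q) + (q - swap q) * (p + swap p) by ring.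
  by apply: symD_spanD; apply: symD_spanM => //; apply: swap_sym.
Qed.

End Swap.

Theorem lemma16 (R : realType) (d : nat) (hd : (1 <= d)%N)
    (f : {mpoly R[d + d]}) (hf : antisymmetric2 f) :
  exists g : 'I_d -> {mpoly R[d + d]},
    (forall l : 'I_d, totally_symmetric (g l)) /\
    f = \sum_(l < d) D R l * g l.
Proof.
(* The second summand of [f + f] becomes [- - f], whose inner [- f] is [swap f] by antisymmetry. *)
rewrite -/(symD_span R d f) -[f]halfZ -{2}[f]opprK -hf.
exact/symD_spanZ/symD_span_sub_swap.
Qed.
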